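(* The following identity holds: $$\pi=\sum_{m=0}^{\infty}\frac{4}{1+2m}\binom{1/2}{m}\,{}_2F_1\!\left(\frac32,\,\frac{1+2m}{2};\,\frac{3+2m}{2};\,-1\right).$$
   Context: $\binom{1/2}{m}=\frac{(1/2)(1/2-1)\cdots(1/2-m+1)}{m!}$ is the generalized binomial coefficient (equal to $1$ for $m=0$). ${}_2F_1(v,u;w;\gamma)$ is the Gauss hypergeometric function (analytically continued to $\mathbb{C}\setminus[1,\infty)$), given for $w>u>0$ and real $\gamma<1$ by Euler's integral ${}_2F_1(v,u;w;\gamma)=\frac{\Gamma(w)}{\Gamma(u)\Gamma(w-u)}\int_0^1\xi^{u-1}(1-\xi)^{w-u-1}(1-\gamma\xi)^{-v}\,d\xi$. *)

(* Defs.v *)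
From mathcomp Require Import all_boot all_order all_algebra.
From mathcomp Require Import all_classical all_reals all_analysis.
Set Implicit Arguments.
Unset Strict Implicit.
Unset Printing Implicit Defensive.

Import Order.TTheory GRing.Theory Num.Theory.

Local Open Scope classical_set_scope.
Local Open Scope ring_scope.

(** Generalized binomial coefficient: [a (a - 1) ... (a - m + 1) / m!]. *)
Definition gbinomial (R : realType) (a : R) (m : nat) : R :=
  (\prod_(i < m) (a - i%:R)) / m`!%:R.

(** Euler's Gamma function; meaningful for [0 < x] (the integral diverges
    otherwise). *)
Definition Gamma (R : realType) (x : R) : R :=
  \int[lebesgue_measure]_(t in `]0, +oo[) (t `^ (x - 1) * expR (- t)).

(** The Gauss hypergeometric function 2F1(v, u; w; g) for real parameters, by
    Euler's integral, which represents it when [0 < u < w] and [g < 1].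
    The integral is a Lebesgue integral; on the open interval all three bases
    of the powers are positive, so [`^] is the usual real power there. *)
Definition hyp2F1 (R : realType) (v u w g : R) : R :=
  Gamma w / (Gamma u * Gamma (w - u)) *
  \int[lebesgue_measure]_(xi in `]0, 1[)
    (xi `^ (u - 1) * (1 - xi) `^ (w - u - 1) * (1 - g * xi) `^ (- v)).

(* Main.v *)
Require Import Defs.
From mathcomp Require Import all_boot all_order all_algebra.
From mathcomp Require Import all_classical all_reals all_analysis.
From mathcomp Require Import measurable_realfun ring lra.
Set Implicit Arguments.
Unset Strict Implicit.
Unset Printing Implicit Defensive.

Import Order.TTheory GRing.Theory Num.Theory.
Import numFieldNormedType.Exports.

Local Open Scope classical_set_scope.
Local Open Scope ring_scope.

(** By Euler's integral and Gamma (u + 1) = u Gamma u, the m-th term equals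
    2 b_m times the integral over ]0, 1[ of x^(m - 1/2) (1 + x)^(-3/2), where
    b_m is the binomial coefficient of 1/2. Let
    P_n(x) = (1 + x)^(-1/2) * sum_(m < n) b_m x^m. The n-th partial sum is then
    the integral of 2 x^(-1/2) / (1 + x) * P_n(x), while the integral of
    2 x^(-1/2) / (1 + x), with antiderivative 4 atan (sqrt x), is pi. The sums
    defining P_n' telescope to - n b_n x^(n - 1) (1 + x)^(-3/2); as |b_n| <= 1,
    this gives |P_n(x) - 1| <= x^n, so that the n-th partial sum is within
    2 / (n + 1/2) of pi. *)

(** * Fundamental theorem of calculus on open intervals, by exhaustion *)

(* Having both [g] and [h] yields integration by parts even when the integrals
   are not known to be finite. *)
Lemma ge0_exhaustion_FTC2 (R : realType) (c d : R^nat) (D : set R)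
    (g h F : R -> R) (l : R) :
  nonincreasing_seq c -> nondecreasing_seq d -> (forall n, c n < d n) ->
  \bigcup_n `[c n, d n]%classic = D ->
  (forall x, D x -> 0 <= g x) -> (forall x, D x -> 0 <= h x) ->
  (forall x, D x -> {for x, continuous g}) ->
  (forall x, D x -> {for x, continuous h}) ->
  (forall x, D x -> is_derive x 1 F (g x - h x)) ->
  F (d n) - F (c n) @[n --> \oo] --> l ->
  (\int[lebesgue_measure]_(x in D) (g x)%:E =
   \int[lebesgue_measure]_(x in D) (h x)%:E + l%:E)%E.
Proof.
move=> cdec dinc cd <-{D} g0 h0 cg ch dF Fl.
set mu := lebesgue_measure; pose E n : set R := `[c n, d n]%classic.
have sub n x : `[c n, d n]%classic x -> (\bigcup_n E n) x by exists n.
have cE (f : R -> R) n : (forall x, (\bigcup_n E n) x -> {for x, continuous f}) ->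
    {within E n, continuous f}.
  by move=> cf; apply: continuous_in_subspaceT => x /set_mem /sub; exact: cf.
have mE (f : R -> R) n : (forall x, (\bigcup_n E n) x -> {for x, continuous f}) ->
    measurable_fun (E n) (EFin \o f).
  move=> cf; apply/measurable_EFinP.
  apply: subspace_continuous_measurable_fun; first exact: measurable_itv.
  exact: cE.
have iE (f : R -> R) n : (forall x, (\bigcup_n E n) x -> {for x, continuous f}) ->
    mu.-integrable (E n) (EFin \o f).
  move=> cf; apply: continuous_compact_integrable; first exact: segment_compact.
  exact: cE.
have ndE : nondecreasing_seq E.
  move=> m n mn; rewrite subsetEset; apply: subset_itv.
  - by rewrite bnd_simp; exact: cdec.
  - by rewrite bnd_simp; exact: dinc.
have cvgE (f : R -> R) : (forall x, (\bigcup_n E n) x -> 0 <= f x) ->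
    (forall x, (\bigcup_n E n) x -> {for x, continuous f}) ->
    (\int[mu]_(x in E n) (f x)%:E @[n --> \oo] -->
     \int[mu]_(x in \bigcup_n E n) (f x)%:E)%E.
  move=> f0 cf; apply: ge0_nondecreasing_set_cvg_integral => //.
  - by move=> n; exact: measurable_itv.
  - by move=> n; exact: mE.
  - by move=> n x /sub /f0; rewrite lee_fin.
have step n : (\int[mu]_(x in E n) (g x)%:E =
    \int[mu]_(x in E n) (h x)%:E + (F (d n) - F (c n))%:E)%E.
  have cF x : E n x -> {for x, continuous F}.
    move=> /sub/dF ?; apply/differentiable_continuous/derivable1_diffP.
    exact: ex_derive.
  have Ec : E n (c n) by rewrite /E /= in_itv/= lexx ltW.
  have Ed : E n (d n) by rewrite /E /= in_itv/= lexx ltW.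
  have := @continuous_FTC2 R (g \- h) F (c n) (d n) (cd n).
  rewrite integralB_EFin//; [|exact: iE|exact: iE].
  rewrite -EFinB => <- //.
  - by rewrite addeC subeK// integrable_fin_num//; exact: iE.
  - apply: cE => x Dx; apply: continuousB; [exact: cg|exact: ch].
  - split.
    + move=> x xcd; have /dF ? : (\bigcup_n E n) x.
        by apply: (sub n); exact: subset_itv_oo_cc.
      exact: ex_derive.
    + by apply: cvg_at_right_filter; exact: cF.
    + by apply: cvg_at_left_filter; exact: cF.
  - move=> x xcd; have /dF ? : (\bigcup_n E n) x.
      by apply: (sub n); exact: subset_itv_oo_cc.
    by rewrite derive1E derive_val.
apply: (cvg_unique _ (cvgE _ g0 cg)) => //.
rewrite /= (funext step).
(* The sum of the limits is defined because [l] is finite, even when the integral of [h] is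
   infinite. *)
apply: cvgeD; [|exact: (cvgE _ h0 ch)|by apply: cvg_EFin; first exact: nearW].
by rewrite fin_num_adde_defl.
Qed.

(** The offset 3 makes [n.+3%:R^-1 < 1 - n.+3%:R^-1] hold from [n = 0] on, so that the segments
    exhausting []0, 1[] are never degenerate. *)
Lemma cvg_invSSS (R : realType) : (n.+3%:R^-1 : R) @[n --> \oo] --> (0 : R).
Proof.
have := @cvg_harmonic R; rewrite -(cvg_shiftn 2) /harmonic/=.
by under eq_fun do rewrite addn2.
Qed.

Lemma invSSS_lt (R : realType) (e : R) : 0 < e -> exists n, n.+3%:R^-1 < e.
Proof.
move=> e0; have [N _ /(_ N)] := near_infty_natSinv_lt (PosNum e0).
move=> /(_ (leqnn N)) /= Ne; exists N; apply: le_lt_trans Ne.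
by rewrite lef_pV2 ?posrE ?ltr0n// ler_nat -addn2 leq_addr.
Qed.

Lemma nonincreasing_invSSS (R : realType) :
  nonincreasing_seq (fun n => n.+3%:R^-1 : R).
Proof. by move=> m n mn; rewrite lef_pV2 ?posrE ?ltr0n// ler_nat. Qed.

Lemma itv01_bigcup (R : realType) :
  \bigcup_n `[n.+3%:R^-1, 1 - n.+3%:R^-1]%classic = `]0, 1[%classic :> set R.
Proof.
apply/seteqP; split => [x [n _] /=|x /=]; rewrite !in_itv/=.
  have c0 : 0 < n.+3%:R^-1 :> R by rewrite invr_gt0.
  by move=> /andP[cx xd]; rewrite (lt_le_trans c0 cx) (le_lt_trans xd)// gtrBl.
move=> /andP[x0 x1]; have m0 : 0 < Num.min x (1 - x).
  by rewrite lt_min x0 subr_gt0.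
have [n] := invSSS_lt m0; rewrite lt_min => /andP[nx n1]; exists n => //=.
by rewrite in_itv/= (ltW nx)/= lerBrDr -lerBrDl ltW.
Qed.

Lemma itv0y_bigcup (R : realType) :
  \bigcup_n `[n.+3%:R^-1, n.+3%:R]%classic = `]0, +oo[%classic :> set R.
Proof.
apply/seteqP; split => [x [n _] /=|x /=]; rewrite !in_itv/= andbT.
  by move=> /andP[+ _]; apply: lt_le_trans; rewrite invr_gt0.
move=> x0; have m0 : 0 < Num.min x x^-1 by rewrite lt_min x0 invr_gt0.
have [n] := invSSS_lt m0; rewrite lt_min => /andP[nx n1]; exists n => //=.
by rewrite in_itv/= (ltW nx)/= ltW// -ltf_pV2 ?posrE.
Qed.

(** This is exhaustion with [h = 0]. Only one-sided limits of [F] enter at the ends, which admits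
    integrands that blow up at 0, such as [x^(-1/2)]. *)
Lemma ge0_FTC2_itv01 (R : realType) (g F : R -> R) (a b : R) :
  (forall x : R, 0 < x < 1 -> 0 <= g x) ->
  (forall x : R, 0 < x < 1 -> {for x, continuous g}) ->
  (forall x : R, 0 < x < 1 -> is_derive x 1 F (g x)) ->
  F x @[x --> 0^'+] --> a -> F x @[x --> 1^'-] --> b ->
  (\int[lebesgue_measure]_(x in `]0%R, 1%R[) (g x)%:E = (b - a)%:E)%E.
Proof.
move=> g0 cg dF Fa Fb.
have c0 n : 0 < n.+3%:R^-1 :> R by rewrite invr_gt0.
apply: (etrans (@ge0_exhaustion_FTC2 _ (fun n => n.+3%:R^-1)
  (fun n => 1 - n.+3%:R^-1) _ g (cst 0) F (b - a) _ _ _ _ _ _ _ _ _ _)).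
- exact: nonincreasing_invSSS.
- by move=> m n mn; rewrite lerD2l lerN2; exact: nonincreasing_invSSS.
- move=> n; rewrite ltrBrDr -mulr2n -[X in X < _]mulr_natr ltr_pdivrMl// mulr1 ltr_nat.
  by [].
- exact: itv01_bigcup.
- exact: g0.
- by [].
- exact: cg.
- by move=> x _; exact: cvg_cst.
- by move=> x x01; rewrite subr0; exact: dF.
- apply: cvgB.
  + move/cvg_at_leftP : Fb; apply; split=> [n|]; first by rewrite gtrBl.
    by rewrite -[X in _ --> X]subr0; apply: cvgB; [exact: cvg_cst|exact: cvg_invSSS].
  + by move/cvg_at_rightP : Fa; apply; split=> //; exact: cvg_invSSS.
- by rewrite integral0 add0e.
Qed.

(** * Real powers on the unit interval *)

Lemma continuous_powRl (R : realType) (a x : R) :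
  0 < x -> {for x, continuous (fun y : R => y `^ a)}.
Proof.
move=> x0; apply/differentiable_continuous/derivable1_diffP.
by apply: derivable_powR; rewrite in_itv/= x0.
Qed.

Lemma integral_powR_itv01 (R : realType) (u : R) : 0 < u ->
  (\int[lebesgue_measure]_(x in `]0%R, 1%R[) (x `^ (u - 1))%:E = (u^-1)%:E)%E.
Proof.
move=> u0; have un0 : u != 0 by rewrite gt_eqF.
rewrite -[X in _ = X%:E]subr0.
apply: (@ge0_FTC2_itv01 _ _ (fun x => u^-1 * x `^ u)).
- by move=> x _; exact: powR_ge0.
- by move=> x /andP[x0 _]; exact: continuous_powRl.
- move=> x /andP[x0 _]; have dp := is_derive1_powR u x0.
  by apply: is_derive_eq; rewrite scalerA mulVf// scale1r.
- by rewrite -[X in _ --> X](mulr0 u^-1); apply: cvgMr; exact: powR_cvg0.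
- rewrite [X in _ --> X](_ : _ = u^-1 * 1 `^ u); last by rewrite powR1 mulr1.
  apply: cvgMr.
  by apply: cvg_at_left_filter; exact: continuous_powRl.
Qed.

(** The dominating function has integral [C / u]. The first conclusion supplies integrability of the
    terms, the second the final error estimate. *)
Lemma powR_dominated_itv01 (R : realType) (u C : R) (f : R -> R) : 0 < u ->
  measurable_fun `]0, 1 : R[ f ->
  (forall x : R, 0 < x < 1 -> `|f x| <= C * x `^ (u - 1)) ->
  lebesgue_measure.-integrable `]0, 1 : R[ (EFin \o f) /\
  `|\int[lebesgue_measure]_(x in `]0, 1[) f x| <= C / u.
Proof.
move=> u0 mf fC.
have mp : measurable_fun `]0, 1 : R[ (fun x : R => x `^ (u - 1)).
  by apply: measurable_funTS; exact: measurable_powR.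
have ip : lebesgue_measure.-integrable `]0, 1 : R[
    (EFin \o (fun x : R => x `^ (u - 1))).
  apply/integrableP; split; first exact/measurable_EFinP.
  under eq_integral do rewrite /= ger0_norm ?powR_ge0//.
  by rewrite integral_powR_itv01// ltry.
have iCp : lebesgue_measure.-integrable `]0, 1 : R[
    (EFin \o (fun x : R => C * x `^ (u - 1))).
  have mI : measurable (`]0, 1[ : set (measurableTypeR R)).
    exact: measurable_itv.
  exact (integrableZl mI C ip).
have intf : lebesgue_measure.-integrable `]0, 1 : R[ (EFin \o f).
  apply: le_integrable iCp => //; first exact/measurable_EFinP.
  move=> x; rewrite /= in_itv/= => x01; rewrite lee_fin.
  by rewrite (le_trans (fC _ x01))// ler_norm.
split=> //; rewrite (le_trans (le_normr_Rintegral _ intf))//.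
rewrite -[leRHS]/(C * fine (u^-1)%:E) -integral_powR_itv01// -RintegralZl//.
by apply: le_Rintegral => //; exact: (integrable_norm intf).
Qed.

(** * The Gamma function: functional equation, finiteness, positivity *)

(* From [s <= expR s] at [s = t / (2 * x)], raised to the power [x]. *)
Lemma powR_expR_le (R : realType) (x t : R) : 0 < x -> 0 < t ->
  t `^ x * expR (- t) <= (2 * x) `^ x * expR (- 2^-1 * t).
Proof.
move=> x0 t0; have x20 : 0 < 2 * x by rewrite mulr_gt0.
have -> : t `^ x = (2 * x) `^ x * (t / (2 * x)) `^ x.
  by rewrite -powRM ?divr_ge0 1?ltW// mulrC divfK// gt_eqF.
have -> : expR (- t) = expR (- 2^-1 * t) * (expR (t / (2 * x)) `^ x)^-1.
  rewrite -expRM -expRN -expRD; congr expR.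
  by field; rewrite gt_eqF.
rewrite mulrACA ler_piMr ?mulr_ge0 ?powR_ge0 ?expR_ge0//.
rewrite ler_pdivrMr ?powR_gt0 ?expR_gt0// mul1r.
rewrite ge0_ler_powR ?nnegrE ?divr_ge0 ?expR_ge0 1?ltW//.
by rewrite (lt_le_trans _ (expR_ge1Dx _))// ltrDr.
Qed.

Lemma expRN_half_le (R : realType) (t : R) : 0 < t -> expR (- 2^-1 * t) <= 2 / t.
Proof.
move=> t0; rewrite mulNr mulrC expRN -[leRHS]invf_div lef_pV2 ?posrE ?expR_gt0 ?divr_gt0//.
by rewrite (le_trans _ (expR_ge1Dx _))// lerDr.
Qed.

Lemma integral_expRN (R : realType) (r : R) : 0 < r ->
  (\int[lebesgue_measure]_(t in `]0%R, +oo[) (expR (- r * t))%:E = (r^-1)%:E)%E.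
Proof.
move=> r0; have mE : measurable_fun `]0 : R, +oo[ (fun t : R => expR (- r * t)).
  by apply: measurable_funTS; apply: measurableT_comp => //; exact: measurable_funM.
have : (\int[lebesgue_measure]_(t in `]0%R, +oo[) (r * expR (- r * t))%:E = 1)%E.
  (* The exponential density of rate [r] has total mass 1. It is supported on the closed half-line,
     whence the change of endpoint. *)
  rewrite -(integral_exponential_pdf r0) integral_itv_obnd_cbnd; last first.
    by apply/measurable_EFinP; exact: measurable_funM.
  rewrite [LHS]integral_mkcond; apply: eq_integral => t _.
  by rewrite /exponential_pdf !patchE; case: ifPn.
under eq_integral do rewrite EFinM.
rewrite ge0_integralZl_EFin ?ltW//; last exact/measurable_EFinP.
move=> /(congr1 (fun y => (r^-1)%:E * y)%E).
by rewrite muleA -EFinM mulVf ?gt_eqF// mul1e mule1.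
Qed.

Lemma measurable_Gamma_integrand (R : realType) (x : R) :
  measurable_fun `]0 : R, +oo[ (fun t : R => t `^ x * expR (- t)).
Proof.
apply: measurable_funTS; apply: measurable_funM; first exact: measurable_powR.
by apply: measurableT_comp => //; exact: measurable_oppr.
Qed.

(** Integration by parts with [F = - t^x e^(-t)], whose boundary values vanish. The equality is
    between extended reals, so that finiteness of the Gamma integral can be deduced from it
    afterwards. *)
Lemma integral_GammaD1 (R : realType) (x : R) : 0 < x ->
  (\int[lebesgue_measure]_(t in `]0%R, +oo[) (t `^ x * expR (- t))%:E =
   x%:E * \int[lebesgue_measure]_(t in `]0%R, +oo[)
     (t `^ (x - 1) * expR (- t))%:E)%E.
Proof.
move=> x0.
have dp (t : R) : 0 < t -> is_derive t 1 (fun t => t `^ x) (x * t `^ (x - 1)).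
  by move=> t0; exact: is_derive1_powR.
have de (t : R) : is_derive t 1 (fun t => expR (- t)) (- expR (- t)).
  by apply: is_derive_eq; rewrite /GRing.scale/=; ring.
have cF (a t : R) : 0 < t -> {for t, continuous (fun t : R => t `^ a * expR (- t))}.
  move=> t0; apply: continuousM; first exact: continuous_powRl.
  by apply: continuous_comp; [exact: continuousN|exact: continuous_expR].
rewrite -ge0_integralZl_EFin ?ltW//; last 2 first.
- by move=> t _; rewrite lee_fin mulr_ge0 ?powR_ge0 ?expR_ge0.
- by apply/measurable_EFinP; exact: measurable_Gamma_integrand.
apply: (etrans (@ge0_exhaustion_FTC2 R (fun n => n.+3%:R^-1) (fun n => n.+3%:R)
  _ (fun t => t `^ x * expR (- t)) (fun t => x * (t `^ (x - 1) * expR (- t)))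
  (fun t => - (t `^ x * expR (- t))) 0 _ _ _ _ _ _ _ _ _ _)).
- exact: nonincreasing_invSSS.
- by move=> m n mn; rewrite ler_nat.
- move=> n; apply: (@lt_trans _ _ 1); last by rewrite ltr1n.
  by rewrite invf_lt1 ?ltr0n// ltr1n.
- exact: itv0y_bigcup.
- by move=> t _; rewrite mulr_ge0 ?powR_ge0 ?expR_ge0.
- by move=> t _; rewrite !mulr_ge0 ?powR_ge0 ?expR_ge0 1?ltW.
- by move=> t; rewrite /= in_itv/= andbT; exact: cF.
- move=> t; rewrite /= in_itv/= andbT => t0.
  by apply: continuousM; [exact: cvg_cst|exact: cF].
- move=> t; rewrite /= in_itv/= andbT => /dp dpt.
  apply: is_derive_eq; rewrite /GRing.scale/=; ring.
(* The two exponential bounds combine to [t^x e^(-t) <= (2 x)^x e^(-t/2) <= C / t], used at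
   [t = n.+3]. At the lower end [t^x] alone tends to 0. *)
- pose C := 2 * (2 * x) `^ x.
  rewrite -[X in _ --> X]subr0 -[in X in _ --> X]oppr0; apply: cvgB; apply: cvgN.
  + apply: (@squeeze_cvgr _ _ _ _ (cst 0) (fun n => C * n.+3%:R^-1)).
    * near=> n; rewrite mulr_ge0 ?powR_ge0 ?expR_ge0//=.
      rewrite (le_trans (powR_expR_le x0 _))//.
      rewrite /C mulrC mulrAC ler_wpM2r ?powR_ge0//.
      exact: expRN_half_le.
    * exact: cvg_cst.
    * by rewrite -[X in _ --> X](mulr0 C); apply: cvgMr; exact: cvg_invSSS.
  + apply: (@squeeze_cvgr _ _ _ _ (cst 0) (fun n => n.+3%:R^-1 `^ x)).
    * near=> n; rewrite mulr_ge0 ?powR_ge0 ?expR_ge0//=.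
      by rewrite ler_piMr ?powR_ge0// -expR0 ler_expR oppr_le0.
    * exact: cvg_cst.
    * have /cvg_at_rightP := powR_cvg0 x0; apply; split => //.
      exact: cvg_invSSS.
- by rewrite adde0; under [LHS]eq_integral do rewrite EFinM.
Unshelve. all: by end_near. Qed.

(** For [x < 1] the integrand is singular at 0. The functional equation replaces it by [t^x e^(-t)],
    which a multiple of [e^(-t/2)] dominates on the whole half-line. *)
Lemma Gamma_integrable (R : realType) (x : R) : 0 < x ->
  lebesgue_measure.-integrable `]0 : R, +oo[
    (fun t : R => (t `^ (x - 1) * expR (- t))%:E).
Proof.
move=> x0; apply/integrableP; split.
  by apply/measurable_EFinP; exact: measurable_Gamma_integrand.
under eq_integral do rewrite /= ger0_norm ?mulr_ge0 ?powR_ge0 ?expR_ge0//.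
(* As [x] is positive, an infinite integral would make the product infinite. *)
suff : (x%:E * \int[lebesgue_measure]_(t in `]0%R, +oo[)
     (t `^ (x - 1) * expR (- t))%:E < +oo)%E.
  case: (integral _ _ _) => [r||]; rewrite ?ltry ?ltNyr//.
  by rewrite gt0_muley ?lte_fin.
rewrite -integral_GammaD1//.
apply: (@le_lt_trans _ _ (((2 * x) `^ x)%:E *
    \int[lebesgue_measure]_(t in `]0%R, +oo[) (expR (- 2^-1 * t))%:E)%E).
  have mE : measurable_fun `]0 : R, +oo[ (fun t : R => expR (- 2^-1 * t)).
    by apply: measurable_funTS; apply: measurableT_comp => //; exact: measurable_funM.
  rewrite -ge0_integralZl_EFin ?powR_ge0//; last exact/measurable_EFinP.
  apply: ge0_le_integral => //.
  - by move=> t _; rewrite lee_fin mulr_ge0 ?powR_ge0 ?expR_ge0.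
  - by apply/measurable_EFinP; exact: measurable_Gamma_integrand.
  - by apply: measurable_funeM; exact/measurable_EFinP.
  - move=> t; rewrite /= in_itv/= andbT => t0; rewrite -EFinM lee_fin.
    exact: powR_expR_le.
by rewrite integral_expRN ?invr_gt0// -EFinM ltry.
Qed.

Lemma GammaD1 (R : realType) (x : R) : 0 < x -> Gamma (x + 1) = x * Gamma x.
Proof.
move=> x0; rewrite /Gamma addrK /Rintegral integral_GammaD1// fineM//.
exact: (integrable_fin_num _ (Gamma_integrable x0)).
Qed.

Lemma Gamma1 (R : realType) : Gamma 1 = 1 :> R.
Proof.
rewrite /Gamma /Rintegral.
under eq_integral do rewrite subrr powRr0 mul1r -mulN1r.
by rewrite integral_expRN// invr1.
Qed.

(** On []0, 1[] one has [e^(-t) >= e^(-1)], so [Gamma x >= e^(-1) / x]. Positivity lets [Gamma u] be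
    cancelled in Euler's formula. *)
Lemma Gamma_gt0 (R : realType) (x : R) : 0 < x -> 0 < Gamma x.
Proof.
move=> x0; have i := Gamma_integrable x0.
rewrite -lte_fin /Gamma fineK; last exact: integrable_fin_num.
apply: (@lt_le_trans _ _ ((expR (- 1))%:E * (x^-1)%:E)%E).
  by rewrite -EFinM lte_fin mulr_gt0 ?expR_gt0 ?invr_gt0.
rewrite -integral_powR_itv01// -ge0_integralZl_EFin ?expR_ge0//; last 2 first.
- by move=> t _; rewrite lee_fin powR_ge0.
- by apply/measurable_EFinP; apply: measurable_funTS; exact: measurable_powR.
apply: (@le_trans _ _ (\int[lebesgue_measure]_(t in `]0%R, 1%R[)
    (t `^ (x - 1) * expR (- t))%:E)%E).
  apply: ge0_le_integral => //.
  - by move=> t _; rewrite lee_fin mulr_ge0 ?powR_ge0 ?expR_ge0.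
  - apply: measurable_funeM; apply/measurable_EFinP.
    by apply: measurable_funTS; exact: measurable_powR.
  - apply: measurable_funS (measurable_int _ i) => //.
    exact: subset_itvl.
  - move=> t; rewrite /= in_itv/= => /andP[t0 t1].
    by rewrite -EFinM lee_fin mulrC ler_wpM2l ?powR_ge0// ler_expR lerN2 ltW.
apply: ge0_subset_integral => //.
- exact: measurable_int i.
- by move=> t _; rewrite lee_fin mulr_ge0 ?powR_ge0 ?expR_ge0.
- exact: subset_itvl.
Qed.

(** * Truncated binomial series of the square root *)

Lemma gbinomialS (R : realType) (a : R) (n : nat) :
  gbinomial a n.+1 = gbinomial a n * (a - n%:R) / n.+1%:R.
Proof.
rewrite /gbinomial big_ord_recr /= factS natrM.
have : n`!%:R != 0 :> R by rewrite pnatr_eq0 -lt0n fact_gt0.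
by move=> ?; field; rewrite addrC natr1 pnatr_eq0.
Qed.

(** The ratio of consecutive coefficients, [(1/2 - n) / (n + 1)], is at most 1 in absolute value. *)
Lemma gbinomial_half_le1 (R : realType) (n : nat) :
  `|gbinomial (1 / 2 : R) n| <= 1.
Proof.
elim: n => [|n ih]; first by rewrite /gbinomial big_ord0 divr1 normr1.
rewrite gbinomialS normrM normfV normrM -mulrA mulr_ile1//.
have n0 : 0 <= n%:R :> R by [].
rewrite (ger0_norm (ler0n _ n.+1)) ler_pdivrMr ?ltr0n// mul1r -(natr1 n).
by rewrite ler_norml; apply/andP; split; lra.
Qed.

(** This is [P_n]: a Taylor polynomial of [sqrt (1 + x)] divided by [sqrt (1 + x)]. The power of
    [1 + x] stays inside the sum so that each summand matches one term of the series. *)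
Definition binomial_half_sum (R : realType) (n : nat) (x : R) : R :=
  \sum_(m < n) gbinomial (1 / 2) m * x ^+ m * (1 + x) `^ (- (1 / 2)).

(** Induction on [n]. Up to the factor [(1 + x)^(-3/2)], the new summand contributes
    [n b_n x^(n-1) (1 + x) - b_n x^n / 2]. Adding [- n b_n x^(n-1)] leaves [(n - 1/2) b_n x^n],
    which is [- (n + 1) b_(n+1) x^n]. *)
Lemma is_derive_binomial_half_sum (R : realType) (n : nat) (x : R) : 0 <= x ->
  is_derive x 1 (binomial_half_sum n)
    (- (n%:R * gbinomial (1 / 2) n * x ^+ n.-1 * (1 + x) `^ (- (3 / 2)))).
Proof.
move=> x0; have x1 : 0 < 1 + x by rewrite ltr_pwDl.
have dp : is_derive x 1 (fun y : R => (1 + y) `^ (- (1 / 2)))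
    (- (1 / 2) * (1 + x) `^ (- (3 / 2))).
  have d1 : is_derive x 1 (fun y : R => 1 + y) 1.
    by have := is_deriveD (is_derive_cst (1 : R) x 1) (is_derive_id x 1); rewrite add0r.
  have d2 := is_derive1_powR (- (1 / 2)) x1.
  have := @is_derive1_comp _ _ (fun y : R => 1 + y) _ _ _ d2 d1.
  by rewrite mulr1 (_ : - (1 / 2) - 1 = - (3 / 2))//; lra.
have split_pow : (1 + x) `^ (- (1 / 2)) = (1 + x) * (1 + x) `^ (- (3 / 2)).
  rewrite (_ : - (1 / 2) = 1 + - (3 / 2)); last by lra.
  by rewrite powRD ?powRr1 ?(ltW x1)// (gt_eqF x1) implybT.
elim: n => [|n ih].
  rewrite (_ : binomial_half_sum 0 = cst 0); last first.
    by apply/funext => y; rewrite /binomial_half_sum big_ord0.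
  by apply: is_derive_eq; rewrite !mul0r oppr0.
rewrite (_ : binomial_half_sum n.+1 = fun y => binomial_half_sum n y +
    gbinomial (1 / 2) n * y ^+ n * (1 + y) `^ (- (1 / 2))); last first.
  by apply/funext => y; rewrite /binomial_half_sum big_ord_recr.
have dX : is_derive x 1 (fun y : R => y ^+ n) (n%:R * x ^+ n.-1).
  by have := is_deriveX n (is_derive_id x 1); rewrite fctE /GRing.scale/= mulr1.
have dT := is_deriveM (is_deriveZ (gbinomial (1 / 2) n) dX) dp.
apply: (is_derive_eq (is_deriveD ih dT)).
rewrite /GRing.scale/= -[gbinomial _ _ *: _]/(gbinomial _ _ * _).
rewrite split_pow gbinomialS.
(* The truncated [n.-1] satisfies [x^n = x * x^(n.-1)] only for positive [n]. At 0 its coefficient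
   vanishes. *)
case: n {ih dX dT} => [|n] /=.
  by rewrite !expr0; field.
rewrite exprS.
by field; rewrite -natrD pnatr_eq0.
Qed.

(** For positive [n], [P_n(0) = 1] and [|P_n'(y)| <= n y^(n-1)], so [s P_n(y) - y^n] is
    nonincreasing on [[0, 1]] whenever [|s| <= 1]. The signs [s = 1] and [s = -1] give the two
    sides. The empty sum [P_0] is 0 rather than 1 at the origin and is treated apart. *)
Lemma binomial_half_sum_bound (R : realType) (n : nat) (x : R) : 0 <= x <= 1 ->
  `|binomial_half_sum n x - 1| <= x ^+ n.
Proof.
move=> /andP[x0 x1]; case: n => [|n].
  by rewrite /binomial_half_sum big_ord0 sub0r normrN normr1 expr0.
suff bound (s : R) : `|s| <= 1 ->
    s * (binomial_half_sum n.+1 x - 1) <= x ^+ n.+1.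
  rewrite ler_norml lerNl; apply/andP; split.
    by have := bound (- 1); rewrite mulN1r normrN normr1; exact.
  by have := bound 1; rewrite mul1r normr1; exact.
move=> s1.
pose H (y : R) := s * binomial_half_sum n.+1 y - y ^+ n.+1.
have dH (y : R) : 0 <= y -> is_derive y 1 H
    (- (n.+1%:R * y ^+ n *
      (s * gbinomial (1 / 2) n.+1 * (1 + y) `^ (- (3 / 2)) + 1))).
  move=> y0; have dS := is_derive_binomial_half_sum n.+1 y0.
  have dX : is_derive y 1 (fun y : R => y ^+ n.+1) (n.+1%:R * y ^+ n).
    by have := is_deriveX n.+1 (is_derive_id y 1); rewrite fctE /GRing.scale/= mulr1.
  apply: (is_derive_eq (is_deriveB (is_deriveZ s dS) dX)).
  by rewrite /GRing.scale/=; ring.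
have : H x <= H 0.
  apply: (@ler0_derive1_le_cc _ H 0 1); rewrite ?in_itv/= ?lexx ?ler01 ?x0//.
  - move=> y; rewrite in_itv/= => /andP[y0 _].
    by have ? := dH y (ltW y0); exact: ex_derive.
  - move=> y; rewrite in_itv/= => /andP[/ltW y0 _].
    have ? := dH y y0; rewrite derive1E derive_val oppr_le0.
    rewrite mulr_ge0 ?mulr_ge0 ?exprn_ge0// -lerBlDr sub0r.
    (* All three factors are at most 1 in absolute value, so the bracket in the derivative of [H] is
       nonnegative. *)
    have : `|s * gbinomial (1 / 2) n.+1 * (1 + y) `^ (- (3 / 2))| <= 1.
      have p1 : (1 + y) `^ (- (3 / 2)) <= 1.
        rewrite powRN invf_le1 ?powR_gt0 ?ltr_pwDl//.
        by rewrite -[leLHS](powRr0 (1 + y)) ler_powR// lerDl.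
      rewrite normrM (ger0_norm (powR_ge0 _ _)) mulr_ile1 ?powR_ge0//.
      by rewrite normrM mulr_ile1 ?normr_ge0 ?gbinomial_half_le1.
    by rewrite ler_norml => /andP[].
  - apply: continuous_in_subspaceT => y; rewrite inE/= in_itv/= => /andP[y0 _].
    apply/differentiable_continuous/derivable1_diffP.
    by have ? := dH y y0; exact: ex_derive.
have S0 : binomial_half_sum n.+1 0 = 1 :> R.
  rewrite /binomial_half_sum big_ord_recl big1 => [|i _].
    by rewrite addr0 /gbinomial big_ord0 divr1 expr0 addr0 powR1 !mulr1.
  by rewrite expr0n/= mulr0 mul0r.
by rewrite /H S0 expr0n/= subr0 mulr1 mulrBr mulr1 lerBlDr -lerBlDl addrC.
Qed.

(** * The limiting integral *)

Lemma continuous_pi_integrand (R : realType) (x : R) : 0 < x ->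
  {for x, continuous (fun x : R => 2 * (x `^ (1 / 2 - 1) / (1 + x)))}.
Proof.
move=> x0; apply: continuousM; first exact: cvg_cst.
apply: continuousM; first exact: continuous_powRl.
apply: continuousV; first by rewrite gt_eqF// ltr_pwDl ?ltW.
by apply: continuousD; [exact: cvg_cst|exact: cvg_id].
Qed.

Lemma integral_pi_itv01 (R : realType) :
  \int[lebesgue_measure]_(x in `]0, 1[) (2 * (x `^ (1 / 2 - 1) / (1 + x)))
  = pi :> R.
Proof.
rewrite -[RHS]subr0 -[RHS]/(fine (pi - 0)%:E); congr fine.
apply: (@ge0_FTC2_itv01 _ _ (fun x => 4 * atan (x `^ (1 / 2)))).
- move=> x /andP[x0 _]; rewrite mulr_ge0 ?divr_ge0 ?powR_ge0//.
  by rewrite addr_ge0 ?ltW.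
- by move=> x /andP[x0 _]; exact: continuous_pi_integrand.
- move=> x /andP[x0 _].
  have dp := is_derive1_powR (1 / 2) x0.
  have da := @is_derive1_comp _ atan (fun y => y `^ (1 / 2)) _ _ _
    (is_derive1_atan (x `^ (1 / 2))) dp.
  apply: (is_derive_eq (is_deriveZ 4 da)).
  rewrite /GRing.scale/= -powR_mulrn ?powR_ge0// -powRrM.
  rewrite (_ : 1 / 2 * 2 = 1); last by lra.
  rewrite powRr1 ?ltW//; field.
  by rewrite gt_eqF// ltr_pwDl ?ltW.
- rewrite -[X in _ --> X](mulr0 4); apply: cvgMr.
  rewrite -[X in _ --> X](@atan0 R).
  apply: continuous_cvg; first exact: continuous_atan.
  by apply: powR_cvg0; lra.
- rewrite [X in _ --> X](_ : _ = 4 * atan (1 `^ (1 / 2))); last first.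
    by rewrite powR1 atan1 mulrC divfK.
  apply: cvgMr; apply: continuous_cvg; first exact: continuous_atan.
  by apply: cvg_at_left_filter; exact: continuous_powRl.
Qed.

(** * Hypergeometric terms as integrals, and the error estimate *)

(** Here [w = u + 1], so the power of [1 - x] is trivial and the Gamma quotient reduces to [u]. *)
Lemma hyp2F1_half (R : realType) (m : nat) :
  hyp2F1 (3 / 2) ((1 + 2 * m%:R) / 2) ((3 + 2 * m%:R) / 2) (- 1 : R) =
  (1 + 2 * m%:R) / 2 * \int[lebesgue_measure]_(x in `]0, 1[)
    (x `^ (1 / 2 - 1) * (x ^+ m * (1 + x) `^ (- (3 / 2)))).
Proof.
set u := (1 + 2 * m%:R) / 2.
have u0 : 0 < u by rewrite divr_gt0// ltr_pwDl// mulr_ge0.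
rewrite /hyp2F1 (_ : (3 + 2 * m%:R) / 2 = u + 1); last by rewrite /u; field.
rewrite GammaD1// (_ : u + 1 - u = 1); last by rewrite addrC addKr.
rewrite Gamma1 mulr1 mulfK ?gt_eqF ?Gamma_gt0//; congr (_ * _).
apply: eq_Rintegral => x; rewrite inE/= in_itv/= => /andP[x0 x1].
rewrite subrr powRr0 mulr1 mulN1r opprK mulrA; congr (_ * _).
rewrite -powR_mulrn ?(ltW x0)// -powRD; last by rewrite (gt_eqF x0) implybT.
by congr (_ `^ _); rewrite /u; field.
Qed.

(** The factor [u = (1 + 2 m) / 2] turns [4 / (1 + 2 m)] into 2. Splitting [(1 + x)^(-3/2)] as
    [(1 + x)^(-1) (1 + x)^(-1/2)] then isolates a weight independent of [m] times the [m]-th summand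
    of [P_n]. *)
Lemma hyp2F1_term (R : realType) (m : nat) :
  let f (x : R) := 2 * (x `^ (1 / 2 - 1) / (1 + x)) *
    (gbinomial (1 / 2) m * x ^+ m * (1 + x) `^ (- (1 / 2))) in
  lebesgue_measure.-integrable `]0, 1 : R[ (EFin \o f) /\
  4 / (1 + 2 * m%:R) * gbinomial (1 / 2 : R) m *
    hyp2F1 (3 / 2) ((1 + 2 * m%:R) / 2) ((3 + 2 * m%:R) / 2) (- 1) =
  \int[lebesgue_measure]_(x in `]0, 1[) f x.
Proof.
move=> f.
pose g (x : R) := x `^ (1 / 2 - 1) * (x ^+ m * (1 + x) `^ (- (3 / 2))).
have fg : {in `]0, 1[%classic, f =1 fun x => 2 * gbinomial (1 / 2) m * g x}.
  move=> x; rewrite inE/= in_itv/= => /andP[x0 x1].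
  have x10 : 0 < 1 + x by rewrite ltr_pwDl ?ltW.
  rewrite /f /g (_ : - (1 / 2) = 1 + - (3 / 2)); last by lra.
  rewrite [in (1 + x) `^ (1 + _)]powRD ?(gt_eqF x10) ?implybT// powRr1 ?(ltW x10)//.
  by field; rewrite gt_eqF.
have ig : lebesgue_measure.-integrable `]0, 1 : R[ (EFin \o g).
  (* Both [x^m] and [(1 + x)^(-3/2)] are at most 1, leaving [x^(-1/2)] as dominating function. *)
  apply: (@powR_dominated_itv01 _ (1 / 2) 1 g _ _ _).1.
  - by lra.
  - apply: measurable_funM.
      by apply: measurable_funTS; exact: measurable_powR.
    apply: measurable_funM; first exact: measurable_funX.
    have m1 : measurable_fun setT (fun y : R => 1 + y) by exact: measurable_funD.
    exact: measurable_funTS (measurableT_comp (measurable_powR (- (3 / 2))) m1).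
  - move=> x /andP[x0 x1]; rewrite mul1r.
    rewrite ger0_norm ?mulr_ge0 ?powR_ge0 ?exprn_ge0 ?(ltW x0)//.
    rewrite ler_piMr ?powR_ge0// mulr_ile1 ?powR_ge0 ?exprn_ge0 ?(ltW x0)//.
      by rewrite exprn_ile1// ltW.
    rewrite powRN invf_le1 ?powR_gt0 ?ltr_pwDl ?(ltW x0)//.
    by rewrite -[leLHS](powRr0 (1 + x)) ler_powR// lerDl ltW.
have mI : measurable (`]0, 1[ : set (measurableTypeR R)) by exact: measurable_itv.
split.
  apply: eq_integrable (integrableZl mI (2 * gbinomial (1 / 2) m) ig) => //.
  by move=> x xI; rewrite /= fg// EFinM.
transitivity (\int[lebesgue_measure]_(x in `]0, 1[)
    (2 * gbinomial (1 / 2) m * g x)); last exact/esym/eq_Rintegral.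
rewrite RintegralZl// hyp2F1_half -/g.
field.
by rewrite gt_eqF// ltr_pwDl// mulr_ge0.
Qed.

Theorem corollary3p6 (R : realType) :
  [series 4 / (1 + 2 * m%:R) * gbinomial (1 / 2 : R) m *
          hyp2F1 (3 / 2) ((1 + 2 * m%:R) / 2) ((3 + 2 * m%:R) / 2) (- 1)]_m
    @ \oo --> (pi : R).
Proof.
pose q (x : R) := 2 * (x `^ (1 / 2 - 1) / (1 + x)).
have mI : measurable (`]0, 1[ : set (measurableTypeR R)) by exact: measurable_itv.
have mq : measurable_fun `]0, 1 : R[ q.
  apply: open_continuous_measurable_fun; first exact: interval_open.
  move=> x; rewrite inE/= in_itv/= => /andP[x0 _].
  exact: continuous_pi_integrand.
have q_le (x : R) : 0 < x < 1 -> 0 <= q x <= 2 * x `^ (1 / 2 - 1).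
  move=> /andP[/ltW x0 _]; have x1 : 0 <= 1 + x by rewrite addr_ge0.
  rewrite /q mulr_ge0 ?divr_ge0 ?powR_ge0//= ler_wpM2l//.
  by rewrite ler_piMr ?powR_ge0// invf_le1 ?lerDl// ltr_pwDl.
have iq : lebesgue_measure.-integrable `]0, 1 : R[ (EFin \o q).
  apply: (@powR_dominated_itv01 _ (1 / 2) 2 q _ mq _).1; first by lra.
  by move=> x /q_le /andP[q0 q2]; rewrite ger0_norm.
pose term m : R := 4 / (1 + 2 * m%:R) * gbinomial (1 / 2 : R) m *
  hyp2F1 (3 / 2) ((1 + 2 * m%:R) / 2) ((3 + 2 * m%:R) / 2) (- 1).
have sumE n : lebesgue_measure.-integrable `]0, 1 : R[
      (EFin \o (fun x => q x * binomial_half_sum n x)) /\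
    series term n =
    \int[lebesgue_measure]_(x in `]0, 1[) (q x * binomial_half_sum n x).
  elim: n => [|n [ih1 ih2]].
    rewrite /series/= big_geq//.
    have -> : (fun x : R => q x * binomial_half_sum 0 x) = cst 0.
      by apply/funext => x; rewrite /binomial_half_sum big_ord0 mulr0.
    by split; [exact: integrable0|rewrite Rintegral_cst// mul0r].
  have [it tE] := hyp2F1_term R n.
  have -> : (fun x : R => q x * binomial_half_sum n.+1 x) =
      fun x => q x * binomial_half_sum n x + q x * (gbinomial (1 / 2) n * x ^+ n *
        (1 + x) `^ (- (1 / 2))).
    by apply/funext => x; rewrite /binomial_half_sum big_ord_recr /= mulrDr.
  split; first exact: (integrableD mI ih1 it).
  by rewrite RintegralD// -ih2 seriesSr; congr (_ + _); exact: tE.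
(* The integrand [q (1 - P_n)] is at most [2 x^(-1/2) x^n], that is [2 x^(u - 1)] with
   [u = 1/2 + n], and domination bounds its integral by [2 / u]. *)
have err n : `|pi - series term n| <= 2 / (1 / 2 + n%:R).
  have [i1 ->] := sumE n; rewrite -integral_pi_itv01 -RintegralB//.
  apply: (@powR_dominated_itv01 _ _ _ (fun x => q x - q x * binomial_half_sum n x) _ _ _).2.
  - by rewrite ltr_pwDl.
  - apply: measurable_funB => //; apply/measurable_EFinP.
    exact: measurable_int i1.
  - move=> x x01; have /andP[q0 q2] := q_le _ x01.
    have /andP[x0 x1] := x01.
    have -> : q x - q x * binomial_half_sum n x =
      - (q x * (binomial_half_sum n x - 1)) by ring.
    rewrite normrN normrM (ger0_norm q0) addrAC powRD; last first.
      by rewrite (gt_eqF x0) implybT.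
    rewrite powR_mulrn ?(ltW x0)// mulrA ler_pM//.
    by apply: binomial_half_sum_bound; rewrite !ltW.
apply/cvgrPdist_le => e e0; near=> n.
apply: (le_trans (err n)); rewrite ler_pdivrMr ?ltr_pwDl// -ler_pdivrMl//.
rewrite (le_trans _ (_ : n%:R <= _)) ?lerDr//.
near: n; exact: nbhs_infty_ger.
Unshelve. all: by end_near. Qed.
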